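(* For any $P,N>0$ with $\frac NP\le\frac{L-1}{L}$ and any $L\in\mathbb{Z}_{\ge2}$, $$\overline{C}_{L-1}(P,N)\ge\frac12\left[\ln\frac{(L-1)P}{LN}+\frac1{L-1}\ln\frac{P}{L(P-N)}\right].$$
   Context: $\mathcal{B}^n(r)$ is the closed Euclidean ball of radius $r$ centered at the origin. For $x_1,\dots,x_L\in\mathbb{R}^n$ with centroid $\bar x=\frac1L\sum_ix_i$, $\overline{\mathrm{rad}}^2(x_1,\dots,x_L)=\frac1L\sum_i\|x_i-\bar x\|_2^2$. A finite $\mathcal{C}\subseteq\mathcal{B}^n(\sqrt{nP})$ is $(P,N,L-1)$-average-radius list-decodable if every $L$ distinct points of $\mathcal{C}$ have $\overline{\mathrm{rad}}^2>nN$. Rate $R(\mathcal{C})=\frac1n\ln|\mathcal{C}|$. $\overline{C}_{L-1}(P,N)=\limsup_{n\to\infty}\sup R(\mathcal{C})$ over such codes in $\mathcal{B}^n(\sqrt{nP})$. *)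

(* Defs.v *)
From HB Require Import structures.
From mathcomp Require Import all_boot all_order all_algebra.
From mathcomp Require Import all_classical all_reals all_analysis.
Set Implicit Arguments. Unset Strict Implicit. Unset Printing Implicit Defensive.
Import Order.TTheory GRing.Theory Num.Theory.
Local Open Scope classical_set_scope.
Local Open Scope ring_scope.

Section Defs.
Variable R : realType.

Definition sqnorm (n : nat) (x : 'rV[R]_n) : R := \sum_(j < n) (x 0 j) ^+ 2.

Definition in_ball (n : nat) (P : R) (x : 'rV[R]_n) : Prop := sqnorm x <= n%:R * P.

Definition centroid (n L : nat) (x : 'I_L -> 'rV[R]_n) : 'rV[R]_n :=
  L%:R^-1 *: \sum_(i < L) x i.

Definition avg_rad2 (n L : nat) (x : 'I_L -> 'rV[R]_n) : R :=
  L%:R^-1 * \sum_(i < L) sqnorm (x i - centroid x).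

(* A code is a finite set of points, represented by a duplicate-free list.
   (P,N,L-1)-average-radius list-decodable code in B^n(sqrt(nP)). *)
Definition ar_list_decodable (n L : nat) (P N : R) (C : seq 'rV[R]_n) : Prop :=
  uniq C /\ (forall c, c \in C -> in_ball P c) /\
  forall x : 'I_L -> 'rV[R]_n, injective x -> (forall i, x i \in C) ->
    n%:R * N < avg_rad2 x.

Definition rate (n : nat) (C : seq 'rV[R]_n) : R := ln (size C)%:R / n%:R.

Definition ar_capacity (L : nat) (P N : R) : \bar R :=
  limn_esup (fun n : nat =>
    ereal_sup [set (rate C)%:E | C in [set C : seq 'rV[R]_n | ar_list_decodable L P N C]]).

End Defs.

(* Main.v *)
Require Import Defs.
From HB Require Import structures.
From mathcomp Require Import all_boot all_order all_algebra.
From mathcomp Require Import all_classical all_reals all_analysis.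
From mathcomp Require Import measurable_realfun lra ring.
Set Implicit Arguments. Unset Strict Implicit. Unset Printing Implicit Defensive.
Import Order.TTheory GRing.Theory Num.Theory.
Import numFieldNormedType.Exports.
Local Open Scope ring_scope.

(** Random coding with expurgation, made finite: codewords are drawn uniformly from the points of
    a fine one-dimensional lattice segment, raised to the power n, that lie in a thin spherical
    shell.  For an L-tuple x write U = |sum_i x_i|^2 / L and V = sum_i |x_i|^2 - U, which is L times
    the squared average radius.  With u = L(P-N)/P and r = LN/((L-1)P), the number of tuples in the
    shell with V <= LnN is at most e^(nL/2) times the sum of the weights exp(-(U/u + V/r)) over all
    tuples of grid points (in units where the shell has squared radius n/2), which factorises over the
    n coordinates.  As the mesh goes to 0 each one-coordinate sum tends to a Gaussian integral,
    proportional to u^(1/2) r^((L-1)/2); the shell itself is counted with the weight exp(-|x|^2),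
    and the Gaussian mass and the exponential factor cancel in the ratio.  The fraction of bad tuples is therefore at most
    (u^(1/2) r^((L-1)/2) + o(1))^n, and choosing a random subset of the shell and deleting one
    point from each surviving bad tuple gives the rate -(ln u / (L-1) + ln r) / 2. *)

(** * Expurgation *)

Section Expurgation.
Variables (R : realFieldType) (T : finType).

Definition subset_weight (q : R) (S : {ffun T -> bool}) : R :=
  \prod_x (if S x then q else 1 - q).

(** Under independent choices this is the probability that the random set contains [e]. The event is
    absorbed into the factors by giving a rejected point of [e] the factor 0; the other points
    contribute q + (1 - q) = 1. *)
Lemma subset_weight_sup (q : R) (e : {set T}) :
  \sum_(S : {ffun T -> bool} | [forall x in e, S x]) subset_weight q S = q ^+ #|e|.
Proof.
pose F (x : T) (b : bool) : R :=
  if x \in e then (if b then q else 0) else (if b then q else 1 - q).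
transitivity (\sum_(S : {ffun T -> bool}) \prod_x F x (S x)).
  rewrite big_mkcond; apply: eq_bigr => S _; rewrite /subset_weight.
  case: (boolP [forall x in e, S x]) => [/forall_inP h|].
    by apply: eq_bigr => x _; rewrite /F; case: (boolP (x \in e)) => // /h ->.
  rewrite negb_forall_in => /exists_inP[x xe /negbTE Sx].
  by rewrite (bigD1 x) //= /F xe Sx mul0r.
rewrite -(bigA_distr_bigA F) -prodr_const [RHS]big_mkcond.
apply: eq_bigr => x _; rewrite big_bool /F.
by case: (x \in e) => /=; [rewrite addr0|rewrite addrC subrK].
Qed.

(* Keep each point independently with probability q, then delete one point from every surviving edge. *)
Lemma hypergraph_independent (q : R) (L : nat) (A : {set T}) (E : {set {set T}}) :
  0 <= q <= 1 -> (0 < L)%N -> (forall e, e \in E -> #|e| = L) ->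
  exists C : {set T}, [/\ C \subset A, forall e, e \in E -> ~~ (e \subset C) &
    q * #|A|%:R - q ^+ L * #|E|%:R <= #|C|%:R].
Proof.
move=> /andP[q0 q1] L0 cE.
pose w := subset_weight q.
have w0 S : 0 <= w S by apply: prodr_ge0 => x _; case: ifP => _ //; lra.
(* Total mass is the case of the empty set; the two sums below are expectations, computed by
   linearity. *)
have wT : \sum_S w S = 1.
  rewrite -(expr0 q) -(cards0 T) -subset_weight_sup; apply: eq_bigl => S.
  by apply/esym/forall_inP => x; rewrite inE.
pose a (S : {ffun T -> bool}) := [set x in A | S x].
pose b (S : {ffun T -> bool}) := [set e in E | [forall x in e, S x]].
have Ea : \sum_S w S * #|a S|%:R = q * #|A|%:R.
  under eq_bigr => S _ do rewrite -sum1_card natr_sum mulr_sumr.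
  transitivity (\sum_(S : {ffun T -> bool}) \sum_(x in A) (if S x then w S else 0)).
    apply: eq_bigr => S _; rewrite -big_mkcondr /=.
    by apply: eq_big => [x|x _]; rewrite ?inE ?mulr1.
  rewrite exchange_big /= -sum1_card natr_sum mulr_sumr; apply: eq_bigr => x _.
  rewrite -big_mkcond mulr1 -[RHS]expr1 -(cards1 x) -subset_weight_sup.
  apply: eq_bigl => S; apply/idP/forall_inP => [h y /set1P -> //|]; apply.
  exact: set11.
have Eb : \sum_S w S * #|b S|%:R = q ^+ L * #|E|%:R.
  under eq_bigr => S _ do rewrite -sum1_card natr_sum mulr_sumr.
  transitivity (\sum_(S : {ffun T -> bool}) \sum_(e in E) (if [forall x in e, S x] then w S else 0)).
    apply: eq_bigr => S _; rewrite -big_mkcondr /=.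
    by apply: eq_big => [x|x _]; rewrite ?inE ?mulr1.
  rewrite exchange_big /= -sum1_card natr_sum mulr_sumr; apply: eq_bigr => e eE.
  by rewrite -big_mkcond mulr1 -(cE e eE) -subset_weight_sup.
set v := _ - _.
(* Some outcome reaches the mean: otherwise nonnegative terms with sum 0 would force every weight to
   vanish, against total mass 1. *)
have [S hS] : exists S, v <= #|a S|%:R - #|b S|%:R.
  apply/existsP; apply: contraT; rewrite negb_exists => /forallP h0.
  have h S : #|a S|%:R - #|b S|%:R < v by rewrite ltNge; exact: h0.
  have /eqP : \sum_S w S * (v - (#|a S|%:R - #|b S|%:R)) = 0.
    under eq_bigr do rewrite !mulrBr.
    by rewrite !sumrB -!mulr_suml wT !mul1r Ea Eb subrr.
  rewrite psumr_eq0 => [/allP h1|S _]; last by rewrite mulr_ge0 // subr_ge0 ltW.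
  suff : (1 : R) = 0 by move/eqP; rewrite oner_eq0.
  rewrite -wT big1 // => S _; have := h1 S (mem_index_enum _).
  by rewrite /= mulf_eq0 subr_eq0 (gt_eqF (h S)) orbF => /eqP.
(* The point to delete from [e], as a singleton. The default, the empty set, is excluded for edges
   by [L0]. *)
pose d (e : {set T}) : {set T} := if [pick x in e] is Some x then [set x] else finset.set0.
have d1 e : (#|d e| <= 1)%N by rewrite /d; case: pickP => *; rewrite ?cards1 ?cards0.
pose D := \bigcup_(e in b S) d e.
have cD : (#|D| <= #|b S|)%N.
  rewrite -[X in (_ <= X)%N]sum1_card /D; elim/big_ind2: _ => [|m X k Y h1 h2|e _]; first by rewrite cards0.
    by apply: leq_trans (leq_add h1 h2); rewrite cardsU leq_subr.
  exact: d1.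
exists (a S :\: D); split.
- apply: fintype.subset_trans (finset.subsetDl _ _) _.
  by apply/fintype.subsetP => x; rewrite inE => /andP[].
- move=> e eE; apply/negP => /fintype.subsetP es.
  have eb : e \in b S.
    by rewrite inE eE; apply/forall_inP => x /es; rewrite !inE => /and3P[].
  have [x xe] : exists x, x \in d e /\ x \in e.
    rewrite /d; case: pickP => [x xe|h]; first by exists x; rewrite set11.
    by move: (cE e eE) L0; rewrite (eq_card0 h) => <-.
  have := es x xe.2; rewrite inE => /andP[/negP h _]; apply: h.
  by apply/bigcupP; exists e => //; exact: xe.1.
- apply: le_trans hS _; rewrite lerBlDr -natrD ler_nat addnC -leq_subLR.
  by rewrite cardsD leq_sub2l // (leq_trans (subset_leq_card (finset.subsetIr _ _))).
Qed.

End Expurgation.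

Local Open Scope classical_set_scope.

(** * Lattice sums of the Gaussian *)

Section GaussLattice.
Variable R : realType.
Notation mu := (@lebesgue_measure R).
Notation gauss := (@gauss_fun R).

Definition gauss_prim (x : R) : R := \int[mu]_(t in `]-oo, x]) gauss t.

Lemma is_derive_gauss_prim (x : R) : is_derive x 1 gauss_prim (gauss x).
Proof.
have [] := @continuous_FTC1 R gauss -oo%O x (x + 1).
- by rewrite ltrDl.
- exact: (integrableS _ _ _ integrableT_gauss).
- exact: ltNyr.
- exact: continuous_gauss_fun.
by move=> d e; apply: DeriveDef => //; rewrite -derive1E.
Qed.

Lemma gauss_prim_ge0 x : 0 <= gauss_prim x.
Proof. by apply: Rintegral_ge0 => t _; exact: gauss_fun_ge0. Qed.

Lemma gauss_prim_le x : gauss_prim x <= Num.sqrt pi.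
Proof.
rewrite /gauss_prim /Rintegral -lee_fin fineK.
  rewrite -integralT_gauss; apply: ge0_subset_integral => //.
    by apply/measurable_EFinP/measurable_funTS; exact: measurable_gauss_fun.
  by move=> t _; rewrite lee_fin gauss_fun_ge0.
by apply: integrable_fin_num => //; exact: (integrableS _ _ _ integrableT_gauss).
Qed.

Lemma gauss_prim_MVT a b : a <= b ->
  exists2 c, a <= c <= b & gauss_prim b - gauss_prim a = gauss c * (b - a).
Proof.
move=> ab; have [|c cab e] := @MVT_segment R gauss_prim gauss a b ab
  (fun x _ => is_derive_gauss_prim x).
  apply: continuous_subspaceT => x.
  have [d _] := is_derive_gauss_prim x.
  exact/differentiable_continuous/derivable1_diffP.
by exists c => //; move: cab; rewrite in_itv.
Qed.

Lemma gauss_prim_homo : {homo gauss_prim : a b / a <= b}.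
Proof.
move=> a b ab; have [c _ e] := gauss_prim_MVT ab.
by rewrite -subr_ge0 e mulr_ge0 ?gauss_fun_ge0 ?subr_ge0.
Qed.

(** Taking the mass as sup minus inf of the range of [gauss_prim] reduces both bounds to order:
    monotonicity carries two near-extremal points to all endpoints further out. *)
Lemma gauss_prim_mass : exists G : R, [/\ 0 < G,
  forall a b, gauss_prim b - gauss_prim a <= G &
  forall e, 0 < e -> exists X : R, forall a b, a <= - X -> X <= b ->
    G - e <= gauss_prim b - gauss_prim a].
Proof.
pose r := range gauss_prim.
have hs : has_sup r.
  split; first by exists (gauss_prim 0), 0.
  by exists (Num.sqrt pi) => _ [x _ <-]; exact: gauss_prim_le.
have hi : has_inf r.
  split; first by exists (gauss_prim 0), 0.
  by exists 0 => _ [x _ <-]; exact: gauss_prim_ge0.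
have up a b : gauss_prim b - gauss_prim a <= sup r - inf r.
  apply: lerB; first by apply: (ub_le_sup hs.2); exists b.
  by apply: (ge_inf hi.2); exists a.
exists (sup r - inf r); split => // [|e e0].
  apply: lt_le_trans (up 0 1); have [c _ ->] := gauss_prim_MVT (@ler01 R).
  by rewrite subr0 mulr1 expR_gt0.
have e2 : 0 < e / 2 by lra.
have [_ [x _ <-] hx] := sup_adherent e2 hs.
have [_ [y _ <-] hy] := inf_adherent e2 hi.
exists (Num.max `|x| `|y|) => a b.
rewrite ge_max lerNr ge_max => /andP[_ ya] /andP[xb _].
have := gauss_prim_homo (le_trans (ler_norm x) xb).
have /gauss_prim_homo : a <= y.
  by move: ya; rewrite lerNr => /le_trans -> //; rewrite lerNl -normrN ler_norm.
by lra.
Qed.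

(* [gauss_var] is the total variation of the Gaussian on ]-oo, x]. *)
Definition gauss_var (x : R) : R := if x <= 0 then gauss x else 2 - gauss x.

Lemma gauss_mono a b : a <= b ->
  (b <= 0 -> gauss a <= gauss b) /\ (0 <= a -> gauss b <= gauss a).
Proof. by move=> ab; split=> h; rewrite ler_expR; nra. Qed.

Lemma gauss_var_bound x y : x <= y -> `|gauss y - gauss x| <= gauss_var y - gauss_var x.
Proof.
move=> xy; rewrite ler_norml /gauss_var.
have [h1 h2] := gauss_mono xy; have := gauss_fun_le1 x; have := gauss_fun_le1 y.
case: (leP x 0) => x0; case: (leP y 0) => y0.
- by have := h1 y0; lra.
- by lra.
- by exfalso; lra.
- by have := h2 (ltW x0); lra.
Qed.

(** On each cell the mean value theorem bounds the error of the Riemann sum by [e] times the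
    variation there. These variations telescope, and the total variation of the Gaussian is at most
    2. *)
Lemma gauss_sum_prim (e h : R) m : 0 <= e ->
  `| e * \sum_(i < m) gauss (e * i%:R + h)
     - (gauss_prim (e * m%:R + h) - gauss_prim h) | <= 2 * e.
Proof.
move=> e0; pose y (i : nat) := e * i%:R + h.
suff H : `| e * \sum_(i < m) gauss (y i) - (gauss_prim (y m) - gauss_prim (y 0)) |
    <= e * (gauss_var (y m) - gauss_var (y 0)).
  have y0 : y 0 = h by rewrite /y mulr0 add0r.
  rewrite y0 in H; apply: (le_trans H); rewrite mulrC ler_wpM2r // /gauss_var.
  have := gauss_fun_le1 (y m); have := gauss_fun_le1 h.
  have := gauss_fun_ge0 (y m); have := gauss_fun_ge0 h.
  by do 2 case: ifP => _; lra.
elim: m => [|m IH]; first by rewrite big_ord0 mulr0 !subrr normr0 mulr0.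
rewrite big_ord_recr /= mulrDr.
have ym : y m <= y m.+1 by rewrite /y -natr1; nra.
have [c /andP[c1 c2] /eqP] := gauss_prim_MVT ym.
rewrite subr_eq => /eqP ->.
have -> : y m.+1 - y m = e by rewrite /y -natr1; ring.
have b1 := gauss_var_bound c1; have b2 := gauss_var_bound c2.
have b3 : `|gauss c - gauss (y m)| <= gauss_var (y m.+1) - gauss_var (y m).
  by have := normr_ge0 (gauss (y m.+1) - gauss c); lra.
move: IH b3; rewrite !ler_norml => /andP[i1 i2] /andP[j1 j2].
have k1 : e * (gauss c - gauss (y m)) <= e * (gauss_var (y m.+1) - gauss_var (y m)).
  exact: ler_wpM2l.
have k2 : e * - (gauss_var (y m.+1) - gauss_var (y m)) <= e * (gauss c - gauss (y m)).
  exact: ler_wpM2l.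
by apply/andP; split; lra.
Qed.

(** The upper bound is uniform in shift and length because no window has mass above [G]. In the
    lower bound, 3 e is the lost tail mass e plus the discretisation error 2 e. *)
Lemma gauss_lattice_sum : exists G : R, [/\ 0 < G,
  forall (e h c : R) m, 0 < e -> 0 < c ->
    \sum_(i < m) gauss (c * (e * i%:R) + h) <= (G / c + 2 * e) / e &
  forall (e H : R), 0 < e -> exists m : nat, exists s : R, forall h, `|h| <= H ->
    (G - 3 * e) / e <= \sum_(i < m) gauss (e * i%:R - s + h)].
Proof.
have [G [G0 up lo]] := gauss_prim_mass; exists G; split => // [e h c m e0 c0|e H e0].
  have ce0 : 0 < c * e by rewrite mulr_gt0.
  have := gauss_sum_prim h m (ltW ce0); have := up h (c * e * m%:R + h).
  under eq_bigr do rewrite -mulrA.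
  set S := \sum_(_ < _) _; rewrite ler_norml => hG /andP[_ hS].
  have -> : (G / c + 2 * e) / e = (G + 2 * (c * e)) / (c * e).
    by field; rewrite (gt_eqF e0) (gt_eqF c0).
  by rewrite ler_pdivlMr // mulrC; lra.
have [X hX] := lo e e0.
(* The grid has length at least 2 s, so after any shift by at most [H] it still covers the interval
   from -X to X. *)
pose s := H + `|X|; pose m := (Num.truncn ((2 * s) / e)).+1.
exists m, s => h; rewrite ler_norml => /andP[h1 h2].
have Xn := ler_norm X; have Xn' : - X <= `|X| by rewrite -normrN ler_norm.
have em : 2 * s <= e * m%:R.
  by rewrite [e * _]mulrC -ler_pdivrMr //; apply: ltW; exact: truncnS_gt.
under eq_bigr do rewrite -addrA.
have := gauss_sum_prim (- s + h) m (ltW e0).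
have := hX (- s + h) (e * m%:R + (- s + h)).
set S := \sum_(_ < _) _; rewrite ler_norml /s => hG /andP[hS _].
rewrite ler_pdivrMr // mulrC.
have : G - e <= gauss_prim (e * m%:R + (- s + h)) - gauss_prim (- s + h).
  by apply: hX; rewrite /s in em *; lra.
by rewrite /s in hS *; lra.
Qed.

End GaussLattice.

(** * Counting grid points and bad tuples *)

Lemma expr_sum_ffun (R : comPzSemiRingType) (I : finType) (F : I -> R) n :
  (\sum_i F i) ^+ n = \sum_(w : {ffun 'I_n -> I}) \prod_j F (w j).
Proof. by rewrite -(bigA_distr_bigA (fun=> F)) prodr_const card_ord. Qed.

Section Grid.
Variables (R : realType) (m L : nat) (v : 'I_m -> R).
Notation gauss := (@gauss_fun R).
Hypothesis L_gt0 : (0 < L)%N.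

Definition col_energy (y : {ffun 'I_L -> 'I_m}) : R := \sum_i v (y i) ^+ 2.
Definition col_sum (y : {ffun 'I_L -> 'I_m}) : R := \sum_i v (y i).
(** The sum of squared deviations from the column mean, by [sum_sqr_centered]. *)
Definition col_spread (y : {ffun 'I_L -> 'I_m}) : R :=
  col_energy y - col_sum y ^+ 2 / L%:R.

(* Hubbard-Stratonovich: the square of the column sum is linearised by a Gaussian sum over
   the auxiliary lattice u, after which the sum over columns factorises. *)
Lemma column_sum_le (m' : nat) (u : 'I_m' -> R) (a b K K' g : R) :
  0 < a -> a <= b -> 0 < g ->
  (forall h, \sum_k gauss (b * v k + h) <= K) ->
  (forall y, g <= \sum_j gauss (u j - Num.sqrt ((b ^+ 2 - a ^+ 2) / L%:R) * col_sum y)) ->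
  \sum_j gauss (a / b * u j) <= K' ->
  \sum_y expR (- (a ^+ 2 * col_energy y + (b ^+ 2 - a ^+ 2) * col_spread y))
    <= K ^+ L * K' / g.
Proof.
move=> a0 ab g0 hK hg hK'.
have b0 : 0 < b by exact: lt_le_trans ab.
have L0 : 0 < L%:R :> R by rewrite ltr0n.
have Ln0 := gt_eqF L0; have bn0 := gt_eqF b0.
have an0 := gt_eqF a0.
have K0 : 0 <= K.
  by apply: le_trans (hK 0); apply: sumr_ge0 => i _; exact: gauss_fun_ge0.
set k := Num.sqrt _ in hg.
have k2 : L%:R * k ^+ 2 = b ^+ 2 - a ^+ 2.
  rewrite sqr_sqrtr; first by field; rewrite Ln0.
  by rewrite divr_ge0 ?ler0n // subr_ge0 ler_sqr ?nnegrE // ltW.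
(* Since L k^2 = b^2 - a^2, the weight of a column is exp(-b^2 E + k^2 S^2) with energy E and sum S.
   Multiplying by the Gaussian at u - k S cancels k^2 S^2 and leaves an exponent that is additive
   over the entries. *)
pose psi j i := expR (- (b ^+ 2 * v i ^+ 2) + 2 * k * u j * v i).
rewrite ler_pdivlMr // mulr_suml.
have step y : expR (- (a ^+ 2 * col_energy y + (b ^+ 2 - a ^+ 2) * col_spread y)) * g
    <= \sum_j gauss (u j) * \prod_i psi j (y i).
  apply: le_trans (ler_wpM2l (expR_ge0 _) (hg y)) _.
  rewrite mulr_sumr le_eqVlt; apply/orP; left; apply/eqP.
  apply: eq_bigr => j _; rewrite /gauss_fun /psi -expR_sum -!expRD; congr expR.
  rewrite big_split /= sumrN -!mulr_sumr -/(col_energy y) -/(col_sum y) /col_spread.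
  rewrite -k2; have := k2; rewrite -/k => k2'.
  have -> : a ^+ 2 = b ^+ 2 - L%:R * k ^+ 2 by rewrite k2; ring.
  by field; rewrite ?Ln0 ?bn0 ?an0.
apply: le_trans (ler_sum _ (fun y _ => step y)) _.
rewrite exchange_big /=.
under eq_bigr do rewrite -mulr_sumr -(bigA_distr_bigA (fun i => psi _)) /=.
apply: le_trans (_ : \sum_j K ^+ L * gauss (a / b * u j) <= _); last first.
  by rewrite -mulr_sumr ler_wpM2l // exprn_ge0.
apply: ler_sum => j _; rewrite prodr_const card_ord.
(* Complete the square in b v - k u / b. *)
have psiE : \sum_i psi j i <= expR (k ^+ 2 * u j ^+ 2 / b ^+ 2) * K.
  apply: le_trans (ler_wpM2l (expR_ge0 _) (hK (- (k * u j / b)))).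
  rewrite mulr_sumr le_eqVlt; apply/orP; left; apply/eqP.
  apply: eq_bigr => i _; rewrite /gauss_fun /psi -expRD; congr expR.
  by field; rewrite ?Ln0 ?bn0 ?an0.
apply: le_trans (_ : gauss (u j) * (expR (k ^+ 2 * u j ^+ 2 / b ^+ 2) * K) ^+ L <= _).
  rewrite ler_wpM2l ?gauss_fun_ge0 // lerXn2r // nnegrE.
    by apply: sumr_ge0 => i _; exact: expR_ge0.
  by rewrite mulr_ge0 ?expR_ge0.
(* The L-th power of the completed square is exp((b^2 - a^2) u^2 / b^2), which turns exp(-u^2) into
   the Gaussian dilated by a / b. *)
rewrite exprMn mulrA mulrC le_eqVlt; apply/orP; left; apply/eqP; congr (_ * _).
rewrite -expRM_natl /gauss_fun -expRD; congr expR.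
have -> : L%:R * (k ^+ 2 * u j ^+ 2 / b ^+ 2) = (L%:R * k ^+ 2) * u j ^+ 2 / b ^+ 2 by ring.
by rewrite k2; field; rewrite gt_eqF.
Qed.

Variable n : nat.

Definition word_energy (w : {ffun 'I_n -> 'I_m}) : R := \sum_j v (w j) ^+ 2.

Definition shell (r s : R) : {set {ffun 'I_n -> 'I_m}} :=
  [set w | n%:R * r <= word_energy w <= n%:R * s].

Lemma sum_word_energy (c : R) :
  \sum_w expR (- (c ^+ 2 * word_energy w)) = (\sum_k gauss (c * v k)) ^+ n.
Proof.
rewrite expr_sum_ffun; apply: eq_bigr => w _.
by rewrite mulr_sumr -sumrN expR_sum; apply: eq_bigr => j _; rewrite /gauss_fun exprMn.
Qed.

(* The two tails are estimated by exponential tilting. *)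
Lemma shell_card_ge (r s c d : R) : 0 <= c <= 1 -> 1 <= d ->
  (\sum_k gauss (1 * v k)) ^+ n
    - ((\sum_k gauss (c * v k)) * expR (- ((1 - c ^+ 2) * s))) ^+ n
    - ((\sum_k gauss (d * v k)) * expR ((d ^+ 2 - 1) * r)) ^+ n
  <= #|shell r s|%:R * expR (- r) ^+ n.
Proof.
move=> /andP[c0 c1] d1.
rewrite !exprMn -!sum_word_energy -!expRM_natl !mulr_suml -sum1_card natr_sum mulr_suml.
rewrite [X in _ <= X]big_mkcond /= -!sumrB; apply: ler_sum => w _; rewrite inE.
rewrite -!expRD.
have p1 := expR_gt0 (- (c ^+ 2 * word_energy w) + n%:R * - ((1 - c ^+ 2) * s)).
have p2 := expR_gt0 (- (d ^+ 2 * word_energy w) + n%:R * ((d ^+ 2 - 1) * r)).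
(* A word below the shell is dominated by the term tilted by [d], one above it by the term tilted by
   [c]; inside, the weight is at most exp(-n r). *)
case: (leP (n%:R * r) (word_energy w)) => hr /=; last first.
  suff : expR (- (1 ^+ 2 * word_energy w)) <=
    expR (- (d ^+ 2 * word_energy w) + n%:R * ((d ^+ 2 - 1) * r)) by lra.
  rewrite ler_expR; have := ltW hr; have : 1 <= d ^+ 2 by rewrite expr_ge1 // (le_trans ler01).
  set D := d ^+ 2; set e := word_energy w; set x := _ * r => D1 he.
  have -> : n%:R * ((D - 1) * r) = (D - 1) * x by rewrite /x; ring.
  by nra.
case: (leP (word_energy w) (n%:R * s)) => hs /=; last first.
  suff : expR (- (1 ^+ 2 * word_energy w)) <=
    expR (- (c ^+ 2 * word_energy w) + n%:R * - ((1 - c ^+ 2) * s)) by lra.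
  rewrite ler_expR; have := ltW hs; have : c ^+ 2 <= 1 by rewrite expr_le1.
  set D := c ^+ 2; set e := word_energy w; set x := _ * s => D1 he.
  have -> : n%:R * - ((1 - D) * s) = - ((1 - D) * x) by rewrite /x; ring.
  by nra.
suff : expR (- (1 ^+ 2 * word_energy w)) <= 1%:R * expR (n%:R * - r) by lra.
by rewrite mul1r ler_expR; lra.
Qed.

(* Tuples of words are indexed by the coordinate first, so that weights factorise over coordinates. *)
Definition tuple_row (Y : {ffun 'I_n -> {ffun 'I_L -> 'I_m}}) (i : 'I_L) :
  {ffun 'I_n -> 'I_m} := [ffun j => Y j i].

Definition bad_tuples (s t : R) : {set {ffun 'I_n -> {ffun 'I_L -> 'I_m}}} :=
  [set Y | [forall i, word_energy (tuple_row Y i) <= n%:R * s] &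
           \sum_j col_spread (Y j) <= L%:R * n%:R * t].

(** An exponential Markov bound: on a bad tuple the weight times the exponential factor is at least
    1, and the sum of the weights over all tuples is an n-th power. *)
Lemma bad_tuples_card (s t a b W : R) : 0 <= a -> a <= b ->
  \sum_y expR (- (a ^+ 2 * col_energy y + (b ^+ 2 - a ^+ 2) * col_spread y)) <= W ->
  #|bad_tuples s t|%:R
    <= (W * expR (L%:R * (a ^+ 2 * s + (b ^+ 2 - a ^+ 2) * t))) ^+ n.
Proof.
move=> a0 ab hW; have b0 := le_trans a0 ab.
pose f y := expR (- (a ^+ 2 * col_energy y + (b ^+ 2 - a ^+ 2) * col_spread y)).
pose z := expR (L%:R * (a ^+ 2 * s + (b ^+ 2 - a ^+ 2) * t)).
apply: le_trans (_ : ((\sum_y f y) * z) ^+ n <= _); last first.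
  have f0 : 0 <= \sum_y f y by apply: sumr_ge0 => y _; exact: expR_ge0.
  by rewrite lerXn2r ?nnegrE ?mulr_ge0 ?expR_ge0 ?(le_trans f0) // ler_wpM2r ?expR_ge0.
rewrite exprMn expr_sum_ffun -expRM_natl mulr_suml.
rewrite -sum1_card natr_sum [X in X <= _]big_mkcond /=; apply: ler_sum => Y _; rewrite inE.
rewrite -expR_sum -expRD; case: ifP => [/andP[/forallP h1 h2]|_]; last exact: expR_ge0.
rewrite -[1%:R]expR0 ler_expR sumrN big_split /= -!mulr_sumr.
have h3 : \sum_j col_energy (Y j) <= L%:R * (n%:R * s).
  rewrite /col_energy exchange_big /=.
  rewrite -[L in X in _ <= X](card_ord L) mulr_natl -sumr_const.
  apply: ler_sum => i _; apply: le_trans (h1 i); rewrite /word_energy.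
  by under [X in _ <= X]eq_bigr do rewrite ffunE.
have A0 : 0 <= a ^+ 2 by rewrite exprn_ge0.
have B0 : 0 <= b ^+ 2 - a ^+ 2 by rewrite subr_ge0 ler_sqr ?nnegrE.
have := ler_wpM2l A0 h3; have := ler_wpM2l B0 h2.
by lra.
Qed.

End Grid.

(** * Codes from independent sets of grid points *)

Section GridCode.
Variables (R : realType) (m L : nat) (v : 'I_m -> R) (n : nat).
Hypotheses (L_gt0 : (0 < L)%N) (v_inj : injective v).
Notation word := {ffun 'I_n -> 'I_m}.

Lemma sum_sqr_centered (z : 'I_L -> R) :
  \sum_i (z i - L%:R^-1 * \sum_i z i) ^+ 2 = \sum_i z i ^+ 2 - (\sum_i z i) ^+ 2 / L%:R.
Proof.
set S := \sum_i z i.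
transitivity (\sum_i (z i ^+ 2 - 2 * (L%:R^-1 * S) * z i + (L%:R^-1 * S) ^+ 2)).
  by apply: eq_bigr => i _; ring.
rewrite !big_split /= sumrN -mulr_sumr sumr_const card_ord -/S -mulr_natl.
by field; rewrite pnatr_eq0 -lt0n.
Qed.

Definition grid_point (c : R) (w : word) : 'rV[R]_n := \row_j (c * v (w j)).

Lemma grid_point_inj c : c != 0 -> injective (grid_point c).
Proof.
move=> c0 w w' /rowP h; apply/ffunP => j; apply: v_inj.
by have := h j; rewrite !mxE => /(mulfI c0).
Qed.

Lemma sqnorm_grid_point c w : sqnorm (grid_point c w) = c ^+ 2 * word_energy v w.
Proof. by rewrite /sqnorm mulr_sumr; apply: eq_bigr => j _; rewrite mxE exprMn. Qed.

Lemma avg_rad2_grid c (Y : {ffun 'I_n -> {ffun 'I_L -> 'I_m}}) :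
  avg_rad2 (fun i => grid_point c (tuple_row Y i))
    = L%:R^-1 * (c ^+ 2 * \sum_j col_spread v (Y j)).
Proof.
congr (_ * _); rewrite /sqnorm exchange_big /= mulr_sumr; apply: eq_bigr => j _.
pose z i := c * v (Y j i).
transitivity (\sum_i (z i - L%:R^-1 * \sum_i z i) ^+ 2).
  apply: eq_bigr => i _; rewrite !mxE summxE ffunE; congr ((_ - _ * _) ^+ 2).
  by apply: eq_bigr => i' _; rewrite !mxE ffunE.
rewrite sum_sqr_centered /col_spread /z -mulr_sumr -/(col_sum v (Y j)).
under eq_bigr do rewrite exprMn.
by rewrite -mulr_sumr -/(col_energy v (Y j)); ring.
Qed.

(** The cardinality condition discards tuples with repeated words, so all edges have size [L] as
    expurgation requires. *)
Definition bad_sets (s t : R) : {set {set word}} :=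
  [set e : {set word} | #|e| == L & [exists Y in bad_tuples L v n s t, e == [set tuple_row Y i | i : 'I_L]]].

Lemma bad_sets_card s t : (#|bad_sets s t| <= #|bad_tuples L v n s t|)%N.
Proof.
pose f (Y : {ffun 'I_n -> {ffun 'I_L -> 'I_m}}) := [set tuple_row Y i | i : 'I_L].
apply: leq_trans (leq_imset_card f (mem (bad_tuples L v n s t))).
apply: subset_leq_card; apply/fintype.subsetP => e.
by rewrite inE => /andP[_ /exists_inP[Y hY /eqP ->]]; apply: imset_f.
Qed.

(** Distinct codewords violating the radius bound would come from a bad tuple whose rows form an
    edge inside [C]. *)
Lemma independent_decodable (c r s t : R) (C : {set word}) : 0 < c ->
  C \subset shell v n r s -> (forall e, e \in bad_sets s t -> ~~ (e \subset C)) ->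
  ar_list_decodable L (c ^+ 2 * s) (c ^+ 2 * t) [seq grid_point c w | w <- enum C].
Proof.
move=> c0 /fintype.subsetP CS Cbad; have cn0 : c != 0 by rewrite gt_eqF.
have c20 : 0 < c ^+ 2 by rewrite exprn_gt0.
have CE w : w \in C -> word_energy v w <= n%:R * s.
  by move/CS; rewrite inE => /andP[].
split; first by rewrite map_inj_uniq ?enum_uniq //; exact: grid_point_inj.
split=> [_ /mapP[w + ->]|x x_inj xC].
  rewrite mem_enum => /CE hw; rewrite /in_ball sqnorm_grid_point mulrCA.
  by rewrite ler_pM2l.
have /fin_all_exists2 [w wC xw] i : exists2 w : word, w \in C & x i = grid_point c w.
  by have /mapP[w] := xC i; rewrite mem_enum; exists w.
pose Y : {ffun 'I_n -> {ffun 'I_L -> 'I_m}} := [ffun j => [ffun i => w i j]].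
have Yw i : tuple_row Y i = w i by apply/ffunP => j; rewrite !ffunE.
have xY : x = fun i => grid_point c (tuple_row Y i) by apply/funext => i; rewrite Yw.
rewrite ltNge; apply/negP => hx.
have e_def : [set tuple_row Y i | i : 'I_L] \in bad_sets s t.
  rewrite inE card_imset ?card_ord ?eqxx /=; last first.
    by move=> i i'; rewrite !Yw => h; apply: x_inj; rewrite !xw h.
  apply/exists_inP; exists Y => //; rewrite inE; apply/andP; split.
    by apply/forallP => i; rewrite Yw CE.
  move: hx; rewrite xY avg_rad2_grid ler_pdivrMl ?ltr0n //.
  have -> : L%:R * (n%:R * (c ^+ 2 * t)) = c ^+ 2 * (L%:R * n%:R * t) by ring.
  by rewrite ler_pM2l.
have /negP := Cbad _ e_def; apply; apply/fintype.subsetP => _ /imsetP[i _ ->].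
by rewrite Yw.
Qed.

Lemma grid_code (c r s t q : R) : 0 < c -> 0 <= q <= 1 ->
  exists2 C : seq 'rV[R]_n, ar_list_decodable L (c ^+ 2 * s) (c ^+ 2 * t) C &
    q * #|shell v n r s|%:R - q ^+ L * #|bad_tuples L v n s t|%:R <= (size C)%:R.
Proof.
move=> c0 q01.
have cB e : e \in bad_sets s t -> #|e| = L by rewrite inE => /andP[/eqP].
have [C [CS Cbad hC]] := hypergraph_independent (shell v n r s) q01 L_gt0 cB.
exists [seq grid_point c w | w <- enum C]; first exact: (independent_decodable c0 CS Cbad).
rewrite size_map -cardE; apply: le_trans hC.
rewrite lerB // ler_wpM2l ?ler_nat ?bad_sets_card //.
by rewrite exprn_ge0 //; case/andP: q01.
Qed.

End GridCode.

(** * Choice of the grid *)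

Section Asymptotics.
Variable R : realType.
Notation gauss := (@gauss_fun R).

(** Used to choose the mesh: each requirement on it becomes positivity of a polynomial at 0. *)
Lemma horner_gt0_near_right (p : {poly R}) (x : R) : 0 < p.[x] ->
  \forall e \near x^'+, 0 < p.[e].
Proof. by apply: cvgr_gt; apply: cvg_at_right_filter; exact: continuous_horner. Qed.

Lemma expr_le_near (x y k : R) : 0 <= x -> x < y -> 0 < k ->
  \forall n \near \oo, x ^+ n <= k * y ^+ n.
Proof.
move=> x0 xy k0; have y0 := le_lt_trans x0 xy.
have : `|x / y| < 1 by rewrite ger0_norm ?divr_ge0 ?(ltW y0) // ltr_pdivrMr ?mul1r.
move=> /cvg_expr /cvgr_le /(_ _ k0); apply: filterS => n.
by rewrite expr_div_n ler_pdivrMr ?exprn_gt0.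
Qed.

(** For a fine mesh the lattice sum at scale c is about 1 / c times that at scale 1, so this makes
    the tail above the shell exponentially small. A tilt of d / 8 is small enough against the shell
    width d for exp y >= 1 + y to suffice. *)
Lemma tilt_down (d : R) : 0 < d < 1 ->
  expR (- ((1 - (1 - d / 8) ^+ 2) * ((1 + d) / 2))) < 1 - d / 8.
Proof.
move=> /andP[d0 d1]; set y := _ * _.
have y0 : 0 <= y by rewrite /y; nra.
rewrite expRN invf_plt ?posrE ?expR_gt0 //; last by lra.
apply: lt_le_trans (expR_ge1Dx y).
rewrite -[(1 - d / 8)^-1]div1r ltr_pdivrMr; last by lra.
have d2 : 0 < d ^+ 2 by rewrite exprn_gt0.
have d3 : 0 < d ^+ 2 * (1 - d) by rewrite mulr_gt0 // subr_gt0.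
have d4 : 0 < d ^+ 4 by rewrite exprn_gt0.
by rewrite /y; lra.
Qed.

Lemma tilt_up (d : R) : 0 < d < 1 ->
  expR (((1 + d / 8) ^+ 2 - 1) * ((1 - d) / 2)) < 1 + d / 8.
Proof.
move=> /andP[d0 d1]; set y := _ * _.
have y1 : 0 < 1 - y by rewrite /y; nra.
rewrite -[X in X < _]invrK -expRN invf_plt ?posrE ?expR_gt0 //; last by lra.
apply: lt_le_trans (expR_ge1Dx (- y)).
rewrite -[(1 + d / 8)^-1]div1r ltr_pdivrMr; last by lra.
have d2 : 0 < d ^+ 2 by rewrite exprn_gt0.
have d3 : 0 < d ^+ 3 by rewrite exprn_gt0.
have d4 : 0 < d ^+ 4 by rewrite exprn_gt0.
by rewrite /y; lra.
Qed.

(** The thickness [d] is fixed first, so that the slack in the hypothesis on [x] absorbs exp(L d);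
    the mesh is chosen afterwards. The four estimates control the two tails, the size of the shell
    and the number of bad tuples. *)
Lemma good_grid (L : nat) (a b x : R) : (0 < L)%N -> 0 < a -> a <= b -> 0 < x ->
  x ^+ L.-1 < a * b ^+ L.-1 ->
  exists d : R, 0 < d < 1 /\ exists m : nat, exists v : 'I_m -> R,
  let Z c := \sum_k gauss (c * v k) in
  let r := (1 - d) / 2 in let s := (1 + d) / 2 in
  [/\ injective v,
    Z (1 - d / 8) * expR (- ((1 - (1 - d / 8) ^+ 2) * s)) < Z 1,
    Z (1 + d / 8) * expR (((1 + d / 8) ^+ 2 - 1) * r) < Z 1,
    x < Z 1 * expR r &
    x ^+ L.-1 * ((\sum_(y : {ffun 'I_L -> 'I_m})
        expR (- (a ^+ 2 * col_energy v y + (b ^+ 2 - a ^+ 2) * col_spread v y)))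
      * expR (L%:R * s)) < (Z 1 * expR r) ^+ L].
Proof.
move=> L0 a0 ab x0 hx; have b0 := lt_le_trans a0 ab.
have [d [d0 d1 hd]] : exists d : R, [/\ 0 < d, d < 1 &
    x ^+ L.-1 * expR (L%:R * d) < a * b ^+ L.-1].
  have cv : x ^+ L.-1 * expR (L%:R * d) @[d --> 0^'+] --> x ^+ L.-1 * expR (L%:R * 0).
    apply: cvg_at_right_filter; apply: cvgM; first exact: cvg_cst.
    apply: continuous_cvg; first exact: continuous_expR.
    by apply: cvgM; [exact: cvg_cst|exact: cvg_id].
  rewrite mulr0 expR0 mulr1 in cv.
  near (0 : R)^'+ => d; exists d; split.
  - by near: d; exact: nbhs_right_gt.
  - by near: d; exact: nbhs_right_lt.
  - by near: d; exact: cvgr_lt cv _ hx.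
have d01 : 0 < d < 1 by rewrite d0.
exists d; split=> //.
have [G [G0 up lo]] := gauss_lattice_sum R.
have t1 := tilt_down d01; have t2 := tilt_up d01.
set c1 := 1 - d / 8 in t1 *; set c2 := 1 + d / 8 in t2 *.
set s := (1 + d) / 2 in t1 *; set r := (1 - d) / 2 in t2 *.
set e1 := expR _ in t1; set e2 := expR _ in t2.
have c10 : 0 < c1 by rewrite /c1; lra.
have c20 : 0 < c2 by rewrite /c2; lra.
have g0 : 0 < a / b by rewrite divr_gt0.
pose C := x ^+ L.-1 * expR (L%:R * d).
pose lin (k l : R) : {poly R} := k%:P + l *: 'X.
have linE k l e : (lin k l).[e] = k + l * e by rewrite !hornerE.
(* With mesh e, q / e bounds the lattice sum at scale 1 from below. [p1] to [p4] are the four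
   estimates after inserting the lattice bounds and clearing powers of e; their values at 0 are the
   Gaussian limits. *)
pose q := lin G (- 3).
pose p1 := q - e1 *: lin (G / c1) 2.
pose p2 := q - e2 *: lin (G / c2) 2.
pose p3 := q - x *: 'X.
pose p4 := q ^+ L.+1 - C *: (lin (G / b) 2 ^+ L * lin (G / (a / b)) 2).
have q0 : 0 < q.[0] by rewrite linE mulr0 addr0.
have p10 : 0 < p1.[0].
  rewrite /p1 hornerD hornerN hornerZ !linE !mulr0 !addr0 subr_gt0 mulrCA.
  by rewrite gtr_pMr // ltr_pdivrMr // mul1r.
have p20 : 0 < p2.[0].
  rewrite /p2 hornerD hornerN hornerZ !linE !mulr0 !addr0 subr_gt0 mulrCA.
  by rewrite gtr_pMr // ltr_pdivrMr // mul1r.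
have p30 : 0 < p3.[0].
  by rewrite /p3 hornerD hornerN hornerZ hornerX mulr0 subr0.
have p40 : 0 < p4.[0].
  rewrite /p4 hornerD hornerN hornerZ hornerM !horner_exp !linE !mulr0 !addr0 subr_gt0.
  have -> : C * ((G / b) ^+ L * (G / (a / b))) = G ^+ L.+1 * (C / (a * b ^+ L.-1)).
    rewrite -(prednK L0) !exprS !expr_div_n /=.
    by field; rewrite !gt_eqF ?exprn_gt0.
  rewrite gtr_pMr ?exprn_gt0 // ltr_pdivrMr ?mul1r // mulr_gt0 // exprn_gt0 //.
near (0 : R)^'+ => e.
have e0 : 0 < e by near: e; exact: nbhs_right_gt.
have qe : 0 < q.[e] by near: e; exact: horner_gt0_near_right.
have p1e : 0 < p1.[e] by near: e; exact: horner_gt0_near_right.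
have p2e : 0 < p2.[e] by near: e; exact: horner_gt0_near_right.
have p3e : 0 < p3.[e] by near: e; exact: horner_gt0_near_right.
have p4e : 0 < p4.[e] by near: e; exact: horner_gt0_near_right.
rewrite linE mulNr in qe.
rewrite /p1 hornerD hornerN hornerZ !linE mulNr subr_gt0 in p1e.
rewrite /p2 hornerD hornerN hornerZ !linE mulNr subr_gt0 in p2e.
rewrite /p3 hornerD hornerN hornerZ hornerX linE mulNr subr_gt0 in p3e.
rewrite /p4 hornerD hornerN hornerZ hornerM !horner_exp !linE mulNr subr_gt0 in p4e.
have [m [h hZ]] := lo e 0 e0.
pose v (i : 'I_m) := e * i%:R - h.
have vE c y : \sum_(k < m) gauss (c * v k + y) =
    \sum_(k < m) gauss (c * (e * k%:R) + (y - c * h)).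
  by apply: eq_bigr => k _; congr gauss; rewrite /v; ring.
have Zle c y : 0 < c -> \sum_(k < m) gauss (c * v k + y) <= (G / c + 2 * e) / e.
  by move=> c0; rewrite vE; exact: up.
pose g := (G - 3 * e) / e.
have gp : 0 < g by rewrite divr_gt0.
have Z1 : g <= \sum_k gauss (1 * v k).
  apply: le_trans (hZ 0 _) _; first by rewrite normr0.
  by rewrite le_eqVlt; apply/orP; left; apply/eqP; apply: eq_bigr => k _; rewrite addr0 mul1r.
have Zp := lt_le_trans gp Z1.
have Zle0 c : 0 < c -> \sum_(k < m) gauss (c * v k) <= (G / c + 2 * e) / e.
  by move=> c0; have := Zle c 0 c0; under eq_bigr do rewrite addr0.
exists m, v; split.
- move=> i j /addIr /(mulfI (lt0r_neq0 e0)) /eqP.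
  by rewrite eqr_nat => /eqP; exact: val_inj.
- apply: le_lt_trans (ler_wpM2r (expR_ge0 _) (Zle0 _ c10)) _.
  apply: lt_le_trans Z1; rewrite -/e1 /g mulrAC ltr_pM2r ?invr_gt0 // mulrC.
  by move: p1e; rewrite mulrC.
- apply: le_lt_trans (ler_wpM2r (expR_ge0 _) (Zle0 _ c20)) _.
  apply: lt_le_trans Z1; rewrite -/e2 /g mulrAC ltr_pM2r ?invr_gt0 // mulrC.
  by move: p2e; rewrite mulrC.
- apply: lt_le_trans (_ : g <= _); first by rewrite /g ltr_pdivlMr.
  apply: le_trans Z1 _; rewrite ler_peMr ?(ltW Zp) //.
  by apply: le_trans (expR_ge1Dx _); rewrite /r; lra.
pose k := Num.sqrt ((b ^+ 2 - a ^+ 2) / L%:R).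
(* The sum dominates each of the finitely many shifts, so one auxiliary lattice serves all
   columns. *)
pose H := \sum_(y : {ffun 'I_L -> 'I_m}) `|- (k * col_sum v y)|.
have [m' [h' hg]] := lo e H e0.
pose u (j : 'I_m') := e * j%:R - h'.
have hg' (y : {ffun 'I_L -> 'I_m}) : g <= \sum_j gauss (u j - k * col_sum v y).
  by apply: hg; rewrite /H (bigD1 y) //= lerDl sumr_ge0.
have hu : \sum_j gauss (a / b * u j) <= (G / (a / b) + 2 * e) / e.
  have := up e (- (a / b * h')) (a / b) m' e0 g0.
  by under eq_bigr do rewrite -mulrBr.
have W := column_sum_le L0 a0 ab gp (fun y => Zle b y b0) hg' hu.
apply: lt_le_trans (_ : (g * expR r) ^+ L <= _); last first.
  apply: lerXn2r; first by rewrite nnegrE mulr_ge0 ?expR_ge0 ?(ltW gp).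
    by rewrite nnegrE mulr_ge0 ?expR_ge0 // ltW.
  exact: ler_wpM2r (expR_ge0 _) _ _ Z1.
have xL : 0 <= x ^+ L.-1 by rewrite exprn_ge0 // ltW.
apply: le_lt_trans (ler_wpM2l xL (ler_wpM2r (expR_ge0 _) W)) _.
(* Here s - r = d. *)
have -> : expR (L%:R * s) = expR (L%:R * d) * expR r ^+ L.
  by rewrite -expRM_natl -expRD; congr expR; rewrite /s /r; field.
rewrite [(g * _) ^+ L]exprMn !mulrA.
rewrite ltr_pM2r ?exprn_gt0 ?expR_gt0 // /g.
have := p4e; rewrite exprS !expr_div_n.
have GL : 0 < (G - 3 * e) ^+ L by rewrite exprn_gt0.
have eL : 0 < e ^+ L by rewrite exprn_gt0.
set A := (_ + _) ^+ L; set B := (_ + _) => hAB.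
have -> : x ^+ L.-1 * (A / e ^+ L) * B / e / ((G - 3 * e) / e) * expR (L%:R * d) =
   C * (A * B) / (e ^+ L * (G - 3 * e)).
  by rewrite /C; field; rewrite !gt_eqF.
have -> : (G - 3 * e) ^+ L / e ^+ L =
    (G - 3 * e) * (G - 3 * e) ^+ L / (e ^+ L * (G - 3 * e)) by field; rewrite !gt_eqF.
by rewrite ltr_pM2r // invr_gt0 mulr_gt0.
Unshelve. all: by end_near. Qed.

End Asymptotics.

(** * The capacity bound *)

Section Capacity.
Variable R : realType.
Notation gauss := (@gauss_fun R).

(** Words of the shell are kept with probability x^n / |shell|, so x^n are expected to survive, and
    the surviving bad tuples are expected to number at most half of that. *)
Lemma large_codes (L : nat) (P N a b x : R) :
  (0 < L)%N -> 0 < P -> 0 <= N -> 0 < a -> a <= b ->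
  a ^+ 2 * P + (b ^+ 2 - a ^+ 2) * N <= P ->
  0 < x -> x ^+ L.-1 < a * b ^+ L.-1 ->
  \forall n \near \oo, exists2 C : seq 'rV[R]_n,
    ar_list_decodable L P N C & x ^+ n / 2 <= (size C)%:R.
Proof.
move=> L0 P0 N0 a0 ab hab x0 hx.
have [d [/andP[d0 d1] [m [v [v_inj z1 z2 z3 z4]]]]] := good_grid L0 a0 ab x0 hx.
move: z1 z2 z3 z4; set s := (1 + d) / 2; set r := (1 - d) / 2.
set Z := \sum_k gauss (1 * v k); set W := \sum_(y : {ffun 'I_L -> 'I_m}) _.
set Zd := _ * expR _; set Zu := _ * expR (_ * r).
move=> z1 z2 z3 z4.
have s0 : 0 < s by rewrite /s; lra.
have r0 : 0 < r by rewrite /r; lra.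
(* [c] rescales the grid so that the outer energy [s] becomes the power [P]; [t] is [N] in grid
   units. *)
pose t := s * N / P; pose c := Num.sqrt (P / s).
have c0 : 0 < c by rewrite sqrtr_gt0 divr_gt0.
have c2 : c ^+ 2 = P / s by rewrite sqr_sqrtr // ltW // divr_gt0.
have PE : P = c ^+ 2 * s by rewrite c2; field; rewrite gt_eqF.
have NE : N = c ^+ 2 * t by rewrite c2 /t; field; rewrite !gt_eqF.
have Z0 : 0 < Z.
  by have := lt_trans x0 z3; rewrite pmulr_lgt0 ?expR_gt0.
have Zd0 : 0 <= Zd.
  by rewrite mulr_ge0 ?expR_ge0 // sumr_ge0 // => k _; exact: gauss_fun_ge0.
have Zu0 : 0 <= Zu.
  by rewrite mulr_ge0 ?expR_ge0 // sumr_ge0 // => k _; exact: gauss_fun_ge0.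
have W0 : 0 <= W by rewrite sumr_ge0 // => y _; exact: expR_ge0.
set tau := Z * expR r in z3 z4.
have tau0 : 0 < tau by rewrite mulr_gt0 ?expR_gt0.
set om := W * expR (L%:R * s) in z4.
have om0 : 0 <= om by rewrite mulr_ge0 ?expR_ge0.
have xom0 : 0 <= x ^+ L.-1 * om by rewrite mulr_ge0 // exprn_ge0 // ltW.
have h4 : 0 < 1 / 4 :> R by lra.
have h2 : 0 < 1 / 2 :> R by lra.
(* The shell will have at least tau^n / 2 words: its L-th power costs 2^-L, and one more half leaves
   x^n / 2 codewords. *)
have hL : 0 < (1 / 2) ^+ L.+1 :> R by rewrite exprn_gt0.
near=> n.
have k1 : Zd ^+ n <= 1 / 4 * Z ^+ n by near: n; exact: (expr_le_near Zd0 z1 h4).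
have k2 : Zu ^+ n <= 1 / 4 * Z ^+ n by near: n; exact: (expr_le_near Zu0 z2 h4).
have k3 : x ^+ n <= 1 / 2 * tau ^+ n.
  by near: n; exact: (expr_le_near (ltW x0) z3 h2).
have k4 : (x ^+ L.-1 * om) ^+ n <= (1 / 2) ^+ L.+1 * (tau ^+ L) ^+ n.
  near: n; exact: (expr_le_near xom0 z4 hL).
set T : R := #|shell v n r s|%:R.
set B : R := #|bad_tuples L v n s t|%:R.
have hT : 1 / 2 * tau ^+ n <= T.
  have cd : 0 <= 1 - d / 8 <= 1 by apply/andP; split; lra.
  have dd : 1 <= 1 + d / 8 by lra.
  have := shell_card_ge v n r s cd dd.
  rewrite -/Z -/Zd -/Zu -/T => h.
  have er : expR (- r) ^+ n * expR r ^+ n = 1.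
    by rewrite -exprMn -expRD addNr expR0 expr1n.
  have : 1 / 2 * Z ^+ n <= T * expR (- r) ^+ n by lra.
  have en : 0 <= expR r ^+ n by rewrite exprn_ge0 // expR_ge0.
  move/(ler_wpM2r en); rewrite -[T * _ * _]mulrA er mulr1.
  by rewrite /tau exprMn mulrA.
have hB : B <= om ^+ n.
  apply: le_trans (bad_tuples_card n s t (ltW a0) ab (lexx W)) _.
  apply: lerXn2r; rewrite ?nnegrE //; first by rewrite mulr_ge0 ?expR_ge0.
  (* The hypothesis [hab], scaled by s / P, bounds the exponent by L s. *)
  apply: ler_wpM2l => //; rewrite ler_expR ler_wpM2l //.
  have -> : a ^+ 2 * s + (b ^+ 2 - a ^+ 2) * t =
      (a ^+ 2 * P + (b ^+ 2 - a ^+ 2) * N) * (s / P).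
    by rewrite /t; field; rewrite gt_eqF.
  rewrite [X in _ <= X](_ : s = P * (s / P)); last by field; rewrite gt_eqF.
  by apply: ler_wpM2r; [rewrite divr_ge0 // ltW|].
have tn0 : 0 < tau ^+ n by rewrite exprn_gt0.
have T0 : 0 < T by apply: lt_le_trans hT; rewrite mulr_gt0.
pose q := x ^+ n / T.
have xn0 : 0 < x ^+ n by rewrite exprn_gt0.
have q0 : 0 <= q by rewrite divr_ge0 // ltW.
have q01 : 0 <= q <= 1.
  by rewrite q0 ler_pdivrMr // mul1r (le_trans k3).
have [C hC szC] := grid_code n L0 v_inj r s t c0 q01.
exists C; first by rewrite PE NE.
apply: le_trans szC; rewrite -/T -/B.
have -> : q * T = x ^+ n by rewrite /q divfK // gt_eqF.
suff : q ^+ L * B <= x ^+ n / 2 by lra.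
apply: le_trans (ler_wpM2l (exprn_ge0 _ q0) hB) _.
rewrite /q expr_div_n mulrAC ler_pdivrMr ?exprn_gt0 //.
have e1 : (x ^+ n) ^+ L * om ^+ n = x ^+ n * (x ^+ L.-1 * om) ^+ n.
  by rewrite [(_ * om) ^+ n]exprMn mulrA -!exprM -exprD -mulSn prednK // mulnC.
rewrite e1 -mulrA ler_pM2l //; apply: le_trans k4 _.
rewrite -exprM mulnC exprM exprS -mulrA -exprMn.
rewrite mul1r ler_pM2l ?invr_gt0 //.
rewrite mul1r in hT; apply: lerXn2r => //; rewrite nnegrE ltW //.
by rewrite mulr_gt0.
Unshelve. all: by end_near. Qed.

Lemma limn_esup_ge_near (u : (\bar R)^nat) (l : \bar R) :
  (\forall n \near \oo, (l <= u n)%E) -> (l <= limn_esup u)%E.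
Proof.
move=> [k _ hk]; rewrite limn_esup_lim; apply: lime_ge; first exact: is_cvg_esups.
apply: nearW => n; apply: le_trans (hk (maxn k n) _) _; first by rewrite /= leq_maxl.
by apply: ereal_sup_ubound; exists (maxn k n) => //=; rewrite leq_maxr.
Qed.

Lemma ar_capacity_ge (L : nat) (P N l : R) :
  (forall e, 0 < e -> \forall n \near \oo, exists2 C : seq 'rV[R]_n,
    ar_list_decodable L P N C & expR (l - e) ^+ n / 2 <= (size C)%:R) ->
  (l%:E <= ar_capacity L P N)%E.
Proof.
move=> h; apply/lee_subgt0Pr => e e0; apply: limn_esup_ge_near.
(* Half of the loss [e] goes to the code, the other half pays for the factor 2, which costs ln 2 / n
   in rate. *)
have e2 : 0 < e / 2 by rewrite divr_gt0.
near=> n.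
have [C hC hs] : exists2 C : seq 'rV[R]_n,
    ar_list_decodable L P N C & expR (l - e / 2) ^+ n / 2 <= (size C)%:R.
  by near: n; exact: h.
apply: le_trans (_ : (rate C)%:E <= _)%E; last by apply: ereal_sup_ubound; exists C.
have n0 : 0 < n%:R :> R by rewrite ltr0n; near: n; exact: nbhs_infty_gt.
have nl : ln 2 / (e / 2) <= n%:R by near: n; exact: nbhs_infty_ger.
have p0 : 0 < expR (l - e / 2) ^+ n / 2 by rewrite divr_gt0 // exprn_gt0 // expR_gt0.
rewrite -EFinB lee_fin /rate ler_pdivlMr //.
have : ln (expR (l - e / 2) ^+ n / 2) <= ln (size C)%:R.
  by rewrite ler_ln // posrE // (lt_le_trans p0).
rewrite ln_div ?posrE ?exprn_gt0 ?expR_gt0 // lnXn ?expR_gt0 // expRK -[_ *+ n]mulr_natl.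
by move: nl; rewrite ler_pdivrMr //; lra.
Unshelve. all: by end_near. Qed.

End Capacity.

Theorem mainTheorem7 (R : realType) (P N : R) (L : nat) :
  0 < P -> 0 < N -> (2 <= L)%N -> N / P <= (L.-1)%:R / L%:R ->
  ((2^-1 * (ln (((L.-1)%:R * P) / (L%:R * N))
            + ((L.-1)%:R)^-1 * ln (P / (L%:R * (P - N)))))%:E
     <= ar_capacity L P N)%E.
Proof.
move=> P0 N0 L2 hNP.
have L0 : 0 < L%:R :> R by rewrite ltr0n (leq_trans _ L2).
have K0 : 0 < L.-1%:R :> R by rewrite ltr0n -ltnS prednK // (leq_trans _ L2).
have LE : L%:R = L.-1%:R + 1 :> R by rewrite natr1 prednK // (leq_trans _ L2).
move: hNP; rewrite ler_pdivrMr // mulrAC ler_pdivlMr // => hNP.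
set u := P / _; set w := L.-1%:R * P / _.
have PN : 0 < P - N by rewrite LE in hNP; nra.
have uP : 0 < u by rewrite divr_gt0 // mulr_gt0.
have wP : 0 < w by rewrite divr_gt0 // mulr_gt0.
have u1 : u <= 1 by rewrite ler_pdivrMr ?mulr_gt0 // mul1r; rewrite LE in hNP *; nra.
have w1 : 1 <= w by rewrite ler_pdivlMr ?mulr_gt0 // mul1r mulrC.
apply: ar_capacity_ge => e e0.
(* Square roots of [u] and [w], which are the reciprocals of the variances u and r of the
   overview. *)
pose a := expR (ln u / 2); pose b := expR (ln w / 2).
have a2 : a ^+ 2 = u by rewrite -expRM_natl mulrC divfK // lnK.
have b2 : b ^+ 2 = w by rewrite -expRM_natl mulrC divfK // lnK.
apply: (large_codes (a := a) (b := b)) => //; rewrite ?expR_gt0 //.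
- exact: leq_trans L2.
- exact: ltW.
- by rewrite ler_expR ler_pM2r ?invr_gt0 // ler_ln ?posrE // (le_trans u1).
(* Equality holds: u (P - N) = P / L and w N = (L - 1) P / L. *)
- rewrite a2 b2 le_eqVlt; apply/orP; left; apply/eqP.
  have -> : u * P + (w - u) * N = u * (P - N) + w * N by ring.
  by rewrite /u /w LE; field; rewrite -LE !gt_eqF.
(* The claimed rate is the exponent at which x^(L-1) equals a b^(L-1); subtracting [e] makes the
   inequality strict. *)
rewrite -!expRM_natl -expRD ltr_expR.
have -> : L.-1%:R * (2^-1 * (ln w + L.-1%:R^-1 * ln u) - e) =
    ln u / 2 + L.-1%:R * (ln w / 2) - L.-1%:R * e by field; rewrite gt_eqF.
by rewrite gtrBl mulr_gt0.
Qed.
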